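(* Let $\mathbb F$ and $\mathbb H$ be bivariant theories on a category $\mathcal C$ with final object $pt$, and let $c_*:F(X)=\mathbb F(X\to pt)\to\mathbb H(X\to pt)=H_*(X)$ be a natural transformation of the associated covariant theories which commutes with exterior products and maps the unit $1_{pt}\in F(pt)$ to the unit $1_{pt}\in H_*(pt)$. For a morphism $f:X\to Y$ let $\widetilde{\mathbb F}(X\xrightarrow{f}Y)$ be the set of all $\alpha\in\mathbb F(X\xrightarrow{f}Y)$ for which there exists a class $B_\alpha\in\mathbb H(X\xrightarrow{f}Y)$ such that for every independent square $$\begin{array}{ccc}X'&\xrightarrow{g'}&X\\ {\scriptstyle f'}\downarrow&&\downarrow{\scriptstyle f}\\ Y'&\xrightarrow{g}&Y\end{array}$$ and every $\beta'\in F(Y')$, $$c_*(g^*\alpha\bullet\beta')=g^*B_\alpha\bullet c_*(\beta').$$ Then $\widetilde{\mathbb F}$ (with the operations of $\mathbb F$) is a bivariant theory. Furthermore $\widetilde{\mathbb F}(X\to pt)=F(X)$.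
   Context: $\mathcal C$ is a category with a final object $pt$ and fiber products, with a class of ''confined'' morphisms (containing identities, closed under composition and under base change in independent squares) and a class of ''independent'' squares, which are Cartesian, contain the identity squares and are closed under horizontal and vertical composition; the product squares over $pt$ are independent, so that exterior products are defined. A bivariant theory $\mathbb B$ on $\mathcal C$ assigns to each morphism $f:X\to Y$ a (graded) abelian group $\mathbb B(X\xrightarrow{f}Y)$ with three operations (homomorphisms): (1) products $\bullet:\mathbb B(X\xrightarrow{f}Y)\otimes\mathbb B(Y\xrightarrow{g}Z)\to\mathbb B(X\xrightarrow{gf}Z)$; (2) pushforwards $f_*:\mathbb B(X\xrightarrow{gf}Z)\to\mathbb B(Y\xrightarrow{g}Z)$ for $f:X\to Y$ confined; (3) pullbacks $g^*:\mathbb B(X\xrightarrow{f}Y)\to\mathbb B(X'\xrightarrow{f'}Y')$ for each independent square with top $g':X'\to X$, bottom $g:Y'\to Y$, left side $f'$ and right side $f$. They satisfy the seven Fulton--MacPherson axioms: product is associative; pushforward is functorial; pullback is functorial; $f_*(\alpha\bullet\beta)=f_*\alpha\bullet\beta$; for independent squares stacked vertically, with $h:Z'\to Z$ at the bottom and $h':Y'\to Y$ in the middle, $h^*(\alpha\bullet\beta)=h'^*\alpha\bullet h^*\beta$; in the same situation with $f:X\to Y$ confined, with base change $f':X'\to Y'$, $h^*(f_*\alpha)=f'_*(h^*\alpha)$; and the projection formula $g'_*(g^*\alpha\bullet\beta)=\alpha\bullet g_*\beta$ for an independent square with $g:Y'\to Y$ confined, $\alpha\in\mathbb B(X\xrightarrow{f}Y)$,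 $\beta\in\mathbb B(Y'\xrightarrow{hg}Z)$, where $h:Y\to Z$. $B_*(X):=\mathbb B(X\to pt)$ is covariant for confined maps. The exterior product of $\alpha\in\mathbb B(X\to pt)$ and $\beta\in\mathbb B(Y'\to pt)$ is $\alpha\times\beta:=g^*\alpha\bullet\beta\in\mathbb B(X\times Y'\to pt)$, where $g:Y'\to pt$. Naturality of $c_*$ means that it is a collection of homomorphisms commuting with pushforward by confined maps; commuting with exterior products means $c_*(\alpha\times\beta)=c_*(\alpha)\times c_*(\beta)$.
   Formalization: Two added assumptions: every independent square over a composite gf splits vertically into independent squares over f and g; and a confined map to Y has an independent base change along the top Y'→Y of any independent square. Without them F~ can fail to be closed under products. *)

(* Defs.v *)
From HB Require Import structures.
From mathcomp Require Import all_boot all_algebra.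
Set Implicit Arguments.
Unset Strict Implicit.
Unset Printing Implicit Defensive.
Import GRing.Theory.
Local Open Scope ring_scope.

Record category := Category {
  obj :> Type;
  mor : obj -> obj -> Type;
  idm : forall X, mor X X;
  mcomp : forall X Y Z, mor Y Z -> mor X Y -> mor X Z;
  mcomp1m : forall X Y (f : mor X Y), mcomp (idm Y) f = f;
  mcompm1 : forall X Y (f : mor X Y), mcomp f (idm X) = f;
  mcompA : forall W X Y Z (f : mor W X) (g : mor X Y) (h : mor Y Z),
    mcomp h (mcomp g f) = mcomp (mcomp h g) f
}.
Arguments mor {c} X Y.
Arguments idm {c} X.
Arguments mcomp {c X Y Z} g f.

Notation "g \oc f" := (mcomp g f) (at level 50, left associativity).

(* Squares are always listed as  top, left, right, bottom:

          X' --g'--> X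
          |          |
          f'         f
          v          v
          Y' --g---> Y                                                      *)
Definition cartesian (C : category) (X' X Y' Y : C)
    (g' : mor X' X) (f' : mor X' Y') (f : mor X Y) (g : mor Y' Y) : Prop :=
  f \oc g' = g \oc f' /\
  forall (W : C) (u : mor W X) (v : mor W Y'), f \oc u = g \oc v ->
    exists! w : mor W X', g' \oc w = u /\ f' \oc w = v.

(* A category with final object and fiber products, together with confined
   morphisms and independent squares, in the sense of Fulton and MacPherson. *)
Record fmCategory := FMCategory {
  fm_cat :> category;
  pt : fm_cat;
  toPt : forall X : fm_cat, mor X pt;
  toPt_uniq : forall (X : fm_cat) (p : mor X pt), p = toPt X;
  fiber_products : forall (X Y Z : fm_cat) (f : mor X Z) (g : mor Y Z),
    exists (P : fm_cat) (p : mor P X) (q : mor P Y), cartesian p q f g;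

  confined : forall X Y : fm_cat, mor X Y -> Prop;
  indep : forall X' X Y' Y : fm_cat,
    mor X' X -> mor X' Y' -> mor X Y -> mor Y' Y -> Prop;

  confined_id : forall X : fm_cat, confined (idm X);
  confined_comp : forall (X Y Z : fm_cat) (f : mor X Y) (g : mor Y Z),
    confined f -> confined g -> confined (g \oc f);
  (* f' is the base change of f along g, and g' that of g along f *)
  confined_left : forall (X' X Y' Y : fm_cat)
      (g' : mor X' X) (f' : mor X' Y') (f : mor X Y) (g : mor Y' Y),
    indep g' f' f g -> confined f -> confined f';
  confined_top : forall (X' X Y' Y : fm_cat)
      (g' : mor X' X) (f' : mor X' Y') (f : mor X Y) (g : mor Y' Y),
    indep g' f' f g -> confined g -> confined g';

  indep_cartesian : forall (X' X Y' Y : fm_cat)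
      (g' : mor X' X) (f' : mor X' Y') (f : mor X Y) (g : mor Y' Y),
    indep g' f' f g -> cartesian g' f' f g;
  indep_id_h : forall (X Y : fm_cat) (f : mor X Y),
    indep (idm X) f f (idm Y);
  indep_id_v : forall (X Y : fm_cat) (f : mor X Y),
    indep f (idm X) (idm Y) f;
  indep_hcomp : forall (X'' X' X Y'' Y' Y : fm_cat)
      (h' : mor X'' X') (g' : mor X' X) (f'' : mor X'' Y'') (f' : mor X' Y')
      (f : mor X Y) (h : mor Y'' Y') (g : mor Y' Y),
    indep h' f'' f' h -> indep g' f' f g ->
    indep (g' \oc h') f'' f (g \oc h);
  indep_vcomp : forall (X' X Y' Y Z' Z : fm_cat)
      (h'' : mor X' X) (f' : mor X' Y') (f : mor X Y) (h' : mor Y' Y)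
      (g' : mor Y' Z') (g : mor Y Z) (h : mor Z' Z),
    indep h'' f' f h' -> indep h' g' g h ->
    indep h'' (g' \oc f') (g \oc f) h;
  indep_product : forall (X Y P : fm_cat) (p : mor P X) (q : mor P Y),
    cartesian p q (toPt X) (toPt Y) -> indep p q (toPt X) (toPt Y)
}.
Arguments pt {_}.
Arguments toPt {_} X.

(* Two converses to closure under vertical composition; both hold when all
   Cartesian squares are independent.  The Fulton-MacPherson axioms constrain
   the pullback of a product or of a pushforward only along vertically stacked
   independent squares, so without them Ftilde below need not be stable under
   products and pushforwards. *)

(* Every independent square over g \oc f is a vertical composite of
   independent squares over f and g. *)
Definition indep_factor (C : fmCategory) : Prop :=
  forall (X' X Y Z' Z : C) (h'' : mor X' X) (k : mor X' Z')
         (f : mor X Y) (g : mor Y Z) (h : mor Z' Z),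
    indep h'' k (g \oc f) h ->
    exists (Y' : C) (h' : mor Y' Y) (f' : mor X' Y') (g' : mor Y' Z'),
      [/\ k = g' \oc f', indep h'' f' f h' & indep h' g' g h].

(* The top side h' of an independent square has independent squares against
   the confined morphisms to its target. *)
Definition indep_lift (C : fmCategory) : Prop :=
  forall (X Y' Y Z' Z : C) (f : mor X Y) (h' : mor Y' Y)
         (g' : mor Y' Z') (g : mor Y Z) (h : mor Z' Z),
    confined f -> indep h' g' g h ->
    exists (X' : C) (h'' : mor X' X) (f' : mor X' Y'), indep h'' f' f h'.

(* Transport of bivariant classes along an equality of morphisms, such as
   associativity of composition. *)
Definition cast (C : category) (B : forall X Y : C, mor X Y -> zmodType)
    (X Y : C) (f f' : mor X Y) (e : f = f') (a : B X Y f) : B X Y f' :=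
  ecast k (B X Y k) e a.
Arguments cast {C B X Y f f'} e a.

(* Groups are ungraded.  The axioms are stated for arbitrary proofs of
   confinedness, independence and equality of morphisms, so that the operations
   depend on the morphisms and squares only. *)
Record bivTheory (C : fmCategory) := BivTheory {
  biv : forall X Y : C, mor X Y -> zmodType;

  bprod : forall (X Y Z : C) (f : mor X Y) (g : mor Y Z),
    biv f -> biv g -> biv (g \oc f);
  push : forall (X Y Z : C) (f : mor X Y) (g : mor Y Z),
    confined f -> biv (g \oc f) -> biv g;
  pull : forall (X' X Y' Y : C)
      (g' : mor X' X) (f' : mor X' Y') (f : mor X Y) (g : mor Y' Y),
    indep g' f' f g -> biv f -> biv f';

  bprodDl : forall (X Y Z : C) (f : mor X Y) (g : mor Y Z)
      (a a' : biv f) (b : biv g),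
    bprod (a + a') b = bprod a b + bprod a' b;
  bprodDr : forall (X Y Z : C) (f : mor X Y) (g : mor Y Z)
      (a : biv f) (b b' : biv g),
    bprod a (b + b') = bprod a b + bprod a b';
  pushD : forall (X Y Z : C) (f : mor X Y) (g : mor Y Z) (cf : confined f)
      (a a' : biv (g \oc f)),
    push cf (a + a') = push cf a + push cf a';
  pullD : forall (X' X Y' Y : C) (g' : mor X' X) (f' : mor X' Y')
      (f : mor X Y) (g : mor Y' Y) (s : indep g' f' f g) (a a' : biv f),
    pull s (a + a') = pull s a + pull s a';

  prod_assoc : forall (W X Y Z : C)
      (f : mor W X) (g : mor X Y) (h : mor Y Z)
      (e : h \oc (g \oc f) = (h \oc g) \oc f)
      (a : biv f) (b : biv g) (c : biv h),
    cast e (bprod (bprod a b) c) = bprod a (bprod b c);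

  push_id : forall (X Y : C) (f : mor X Y) (ci : confined (idm X))
      (e : f \oc idm X = f) (a : biv (f \oc idm X)),
    push ci a = cast e a;
  push_comp : forall (W X Y Z : C)
      (f : mor W X) (g : mor X Y) (h : mor Y Z)
      (cf : confined f) (cg : confined g) (cgf : confined (g \oc f))
      (e : h \oc (g \oc f) = (h \oc g) \oc f) (a : biv (h \oc (g \oc f))),
    push cgf a = push cg (push cf (cast e a));

  pull_id : forall (X Y : C) (f : mor X Y)
      (s : indep (idm X) f f (idm Y)) (a : biv f),
    pull s a = a;
  pull_comp : forall (X'' X' X Y'' Y' Y : C)
      (h' : mor X'' X') (g' : mor X' X) (f'' : mor X'' Y'') (f' : mor X' Y')
      (f : mor X Y) (h : mor Y'' Y') (g : mor Y' Y)
      (s : indep h' f'' f' h) (t : indep g' f' f g)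
      (st : indep (g' \oc h') f'' f (g \oc h)) (a : biv f),
    pull st a = pull s (pull t a);

  push_prod : forall (W X Y Z : C)
      (f : mor W X) (g : mor X Y) (h : mor Y Z) (cf : confined f)
      (e : h \oc (g \oc f) = (h \oc g) \oc f)
      (a : biv (g \oc f)) (b : biv h),
    push cf (cast e (bprod a b)) = bprod (push cf a) b;

  pull_prod : forall (X' X Y' Y Z' Z : C)
      (h'' : mor X' X) (f' : mor X' Y') (f : mor X Y) (h' : mor Y' Y)
      (g' : mor Y' Z') (g : mor Y Z) (h : mor Z' Z)
      (s : indep h'' f' f h') (t : indep h' g' g h)
      (st : indep h'' (g' \oc f') (g \oc f) h) (a : biv f) (b : biv g),
    pull st (bprod a b) = bprod (pull s a) (pull t b);

  pull_push : forall (X' X Y' Y Z' Z : C)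
      (h'' : mor X' X) (f' : mor X' Y') (f : mor X Y) (h' : mor Y' Y)
      (g' : mor Y' Z') (g : mor Y Z) (h : mor Z' Z)
      (s : indep h'' f' f h') (t : indep h' g' g h)
      (st : indep h'' (g' \oc f') (g \oc f) h)
      (cf : confined f) (cf' : confined f') (a : biv (g \oc f)),
    pull t (push cf a) = push cf' (pull st a);

  projection_formula : forall (X' X Y' Y Z : C)
      (g' : mor X' X) (f' : mor X' Y') (f : mor X Y) (g : mor Y' Y)
      (h : mor Y Z) (s : indep g' f' f g)
      (cg : confined g) (cg' : confined g')
      (e : (h \oc g) \oc f' = (h \oc f) \oc g')
      (a : biv f) (b : biv (h \oc g)),
    push cg' (cast e (bprod (pull s a) b)) = bprod a (push cg b)
}.
Arguments biv {C} _ {X Y} f.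
Arguments bprod {C _ X Y Z f g} _ _.
Arguments push {C _ X Y Z f g} _ _.
Arguments pull {C _ X' X Y' Y g' f' f g} _ _.

(* The associated covariant theory B_*(X) = B(X -> pt). *)
Definition cov (C : fmCategory) (B : bivTheory C) (X : C) : zmodType :=
  biv B (toPt X).

Definition cov_push (C : fmCategory) (B : bivTheory C) (X Y : C)
    (f : mor X Y) (cf : confined f) (a : cov B X) : cov B Y :=
  push cf (cast (B := @biv C B) (esym (toPt_uniq (toPt Y \oc f))) a).

(* The product with a class over pt, with values in B_*(X). *)
Definition prod_cov (C : fmCategory) (B : bivTheory C) (X Y : C)
    (f : mor X Y) (a : biv B f) (b : cov B Y) : cov B X :=
  cast (B := @biv C B) (toPt_uniq (toPt Y \oc f)) (bprod a b).

(* The exterior product a \times b = g^*a \bullet b, with g = toPt Y, formed on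
   any fiber product P of X and Y over pt. *)
Definition ext_prod (C : fmCategory) (B : bivTheory C) (X Y P : C)
    (p : mor P X) (q : mor P Y) (s : cartesian p q (toPt X) (toPt Y))
    (a : cov B X) (b : cov B Y) : cov B P :=
  prod_cov (pull (indep_product s) a) b.

(* u is the unit 1_pt, an identity for products on both sides. *)
Definition is_unit_pt (C : fmCategory) (B : bivTheory C)
    (u : cov B pt) : Prop :=
  (forall (X : C) (a : cov B X), prod_cov a u = a) /\
  (forall (Z : C) (g : mor pt Z) (e : g \oc toPt pt = g) (b : biv B g),
     cast (B := @biv C B) e (bprod u b) = b).

Definition Ftilde (C : fmCategory) (F H : bivTheory C)
    (c : forall X : C, {additive cov F X -> cov H X})
    (X Y : C) (f : mor X Y) (a : biv F f) : Prop :=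
  exists Ba : biv H f,
    forall (X' Y' : C) (g' : mor X' X) (f' : mor X' Y') (g : mor Y' Y)
           (s : indep g' f' f g) (b' : cov F Y'),
      c X' (prod_cov (pull s a) b') = prod_cov (pull s Ba) (c Y' b').

(* The subsets P f of the groups F(f), with the operations of F, form a
   bivariant theory: there is a bivariant theory G whose groups are identified
   by injections i with the P f and whose operations are those of F. *)
Definition is_bivariant_subtheory (C : fmCategory) (F : bivTheory C)
    (P : forall (X Y : C) (f : mor X Y), biv F f -> Prop) : Prop :=
  exists (G : bivTheory C)
         (i : forall (X Y : C) (f : mor X Y), {additive biv G f -> biv F f}),
  [/\ forall (X Y : C) (f : mor X Y), injective (i X Y f),
      forall (X Y : C) (f : mor X Y) (a : biv F f),
        P X Y f a <-> exists x : biv G f, i X Y f x = a,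
      forall (X Y Z : C) (f : mor X Y) (g : mor Y Z)
             (x : biv G f) (y : biv G g),
        i X Z (g \oc f) (bprod x y) = bprod (i X Y f x) (i Y Z g y),
      forall (X Y Z : C) (f : mor X Y) (g : mor Y Z) (cf : confined f)
             (x : biv G (g \oc f)),
        i Y Z g (push cf x) = push cf (i X Z (g \oc f) x)
    & forall (X' X Y' Y : C) (g' : mor X' X) (f' : mor X' Y')
             (f : mor X Y) (g : mor Y' Y) (s : indep g' f' f g)
             (x : biv G f),
        i X' Y' f' (pull s x) = pull s (i X Y f x)].

(* Main.v *)
Require Import Defs.
From HB Require Import structures.
From mathcomp Require Import all_boot all_algebra.
From mathcomp Require Import boolp.
Set Implicit Arguments.
Unset Strict Implicit.
Unset Printing Implicit Defensive.
Import GRing.Theory.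
Local Open Scope ring_scope.

(** The classes [B_alpha] are propagated along the three operations:
    [B_(alpha . beta) = B_alpha . B_beta], [B_(f_* alpha) = f_* B_alpha] and
    [B_(g^* alpha) = g^* B_alpha].  For products the test square over [g f] is
    first split into squares over [f] and [g]; for pushforwards the test square
    over [g] is first extended to one over [g f].  Over a point every test
    square is a product square, so compatibility with exterior products says
    that [B_alpha = c_* alpha] works. *)

Record subgroup (V : zmodType) := Subgroup {
  subgroup_mem :> V -> Prop;
  subgroup0 : subgroup_mem 0;
  subgroupB : forall x y, subgroup_mem x -> subgroup_mem y ->
    subgroup_mem (x - y)
}.

(** Membership in [Ftilde] is an existential proposition; classical logic turns it into the Boolean
    predicate from which the group structure on the subgroup is built. *)
Definition subgroup_pred (V : zmodType) (S : subgroup V) : {pred V} :=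
  fun x => `[< S x >].

Lemma subgroup_predP (V : zmodType) (S : subgroup V) (x : V) :
  reflect (S x) (x \in subgroup_pred S).
Proof. exact: asboolP. Qed.

Lemma subgroup_zmod_closed (V : zmodType) (S : subgroup V) :
  zmod_closed (subgroup_pred S).
Proof.
split; first by apply/subgroup_predP; exact: subgroup0.
by move=> x y /subgroup_predP Sx /subgroup_predP Sy;
  apply/subgroup_predP; exact: subgroupB.
Qed.

HB.instance Definition _ (V : zmodType) (S : subgroup V) :=
  GRing.isZmodClosed.Build V (subgroup_pred S) (subgroup_zmod_closed S).

Record subgroup_type (V : zmodType) (S : subgroup V) := SubgroupType {
  subgroup_val : V;
  subgroup_valP : subgroup_val \in subgroup_pred S
}.

HB.instance Definition _ (V : zmodType) (S : subgroup V) :=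
  [isSub for @subgroup_val V S].
HB.instance Definition _ (V : zmodType) (S : subgroup V) :=
  [Choice of subgroup_type S by <:].
HB.instance Definition _ (V : zmodType) (S : subgroup V) :=
  [SubChoice_isSubZmodule of subgroup_type S by <:].

Definition subgroup_inj (V : zmodType) (S : subgroup V) :
  {additive subgroup_type S -> V} := (val : subgroup_type S -> V).

Definition subgroup_in (V : zmodType) (S : subgroup V) (x : V) (Sx : S x) :
  subgroup_type S := SubgroupType (introT (subgroup_predP S x) Sx).

Lemma subgroup_memP (V : zmodType) (S : subgroup V) (x : subgroup_type S) :
  S (val x).
Proof. by apply/subgroup_predP; exact: subgroup_valP. Qed.

Lemma val_cast (C : category) (B : forall X Y : C, mor X Y -> zmodType)
    (S : forall (X Y : C) (f : mor X Y), subgroup (B X Y f))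
    (X Y : C) (f f' : mor X Y) (e : f = f') (x : subgroup_type (S X Y f)) :
  val (cast (B := fun X Y f => subgroup_type (S X Y f)) e x) =
  cast (B := B) e (val x).
Proof. by case: f' / e. Qed.

(** All the axioms are identities between classes. The inclusions into the groups of [F] are
    injective and commute with the operations and with transport, so each identity is inherited from
    [F]. *)
Lemma closed_bivariant_subtheory (C : fmCategory) (F : bivTheory C)
    (P : forall (X Y : C) (f : mor X Y), biv F f -> Prop)
    (P0 : forall (X Y : C) (f : mor X Y), P X Y f 0)
    (PB : forall (X Y : C) (f : mor X Y) (a b : biv F f),
       P X Y f a -> P X Y f b -> P X Y f (a - b))
    (P_prod : forall (X Y Z : C) (f : mor X Y) (g : mor Y Z)
       (a : biv F f) (b : biv F g),
       P X Y f a -> P Y Z g b -> P X Z (g \oc f) (bprod a b))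
    (P_push : forall (X Y Z : C) (f : mor X Y) (g : mor Y Z)
       (cf : confined f) (a : biv F (g \oc f)),
       P X Z (g \oc f) a -> P Y Z g (push cf a))
    (P_pull : forall (X' X Y' Y : C) (g' : mor X' X) (f' : mor X' Y')
       (f : mor X Y) (g : mor Y' Y) (s : indep g' f' f g) (a : biv F f),
       P X Y f a -> P X' Y' f' (pull s a)) :
  is_bivariant_subtheory P.
Proof.
pose S X Y (f : mor X Y) := Subgroup (P0 X Y f) (PB X Y f).
pose T X Y (f : mor X Y) : zmodType := subgroup_type (S X Y f).
pose Gprod X Y Z (f : mor X Y) (g : mor Y Z) (x : T X Y f) (y : T Y Z g) :
    T X Z (g \oc f) :=
  subgroup_in (S := S X Z (g \oc f))
    (P_prod X Y Z f g (val x) (val y) (subgroup_memP x) (subgroup_memP y)).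
pose Gpush X Y Z (f : mor X Y) (g : mor Y Z) (cf : confined f)
    (x : T X Z (g \oc f)) : T Y Z g :=
  subgroup_in (S := S Y Z g) (P_push X Y Z f g cf (val x) (subgroup_memP x)).
pose Gpull X' X Y' Y (g' : mor X' X) (f' : mor X' Y') (f : mor X Y)
    (g : mor Y' Y) (s : indep g' f' f g) (x : T X Y f) : T X' Y' f' :=
  subgroup_in (S := S X' Y' f')
    (P_pull X' X Y' Y g' f' f g s (val x) (subgroup_memP x)).
have vcast X Y (f f' : mor X Y) (e : f = f') (x : T X Y f) :
    val (cast (B := T) e x) = cast (B := @biv C F) e (val x).
  exact: (@val_cast C (@biv C F) S).
unshelve refine (let G := @BivTheory C T Gprod Gpush Gpull
  _ _ _ _ _ _ _ _ _ _ _ _ _ in _).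
(* Thirteen goals are the axioms of [G]; the fourteenth, taken first, is that [G] with the
   inclusions realizes [P]. *)
14: {
  exists G, (fun X Y f => subgroup_inj (S X Y f)); split=> //.
  - by move=> X Y f; exact: val_inj.
  - move=> X Y f a; split=> [Pa | [x <-]]; last exact: (subgroup_memP x).
    by exists (subgroup_in (S := S X Y f) Pa).
}
all: intros; apply: val_inj; rewrite /= ?vcast /=.
- exact: bprodDl.
- exact: bprodDr.
- exact: pushD.
- exact: pullD.
- exact: prod_assoc.
- exact: push_id.
- exact: push_comp.
- exact: pull_id.
- exact: pull_comp.
- exact: push_prod.
- exact: pull_prod.
- exact: pull_push.
- exact: projection_formula.
Qed.

Lemma cast_trans (C : category) (B : forall X Y : C, mor X Y -> zmodType)
    (X Y : C) (f g h : mor X Y) (e : f = g) (e' : g = h) (a : B X Y f) :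
  cast e' (cast e a) = cast (etrans e e') a.
Proof. by case: h / e'; case: g / e. Qed.

Lemma castK (C : category) (B : forall X Y : C, mor X Y -> zmodType)
    (X Y : C) (f g : mor X Y) (e : f = g) (a : B X Y g) :
  cast e (cast (esym e) a) = a.
Proof. by case: g / e a. Qed.

Lemma castD (C : category) (B : forall X Y : C, mor X Y -> zmodType)
    (X Y : C) (f g : mor X Y) (e : f = g) (a b : B X Y f) :
  cast e (a + b) = cast e a + cast e b.
Proof. by case: g / e. Qed.

(* Functoriality of pushforward along the identity holds for every proof of
   [f \oc idm = f], so transport does not depend on the proof of equality even
   though the type of morphisms need not be a set. *)
Lemma cast_loop (C : fmCategory) (B : bivTheory C) (X Y : C) (f : mor X Y)
    (e : f = f) (a : biv B f) : cast (B := @biv C B) e a = a.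
Proof.
have u := mcompm1 f; rewrite -{1}(castK (B := @biv C B) u a).
by rewrite cast_trans -(push_id (confined_id X)) (push_id _ u) castK.
Qed.

Lemma cast_irrelevance (C : fmCategory) (B : bivTheory C) (X Y : C)
    (f g : mor X Y) (e e' : f = g) (a : biv B f) :
  cast (B := @biv C B) e a = cast (B := @biv C B) e' a.
Proof. by case: g / e e' => e'; rewrite !cast_loop. Qed.

(** Functoriality is available for every proof that the composite square is independent. Composing
    with an identity square thus identifies both pullbacks with [pull st a]. *)
Lemma pull_irrelevance (C : fmCategory) (B : bivTheory C) (X' X Y' Y : C)
    (g' : mor X' X) (f' : mor X' Y') (f : mor X Y) (g : mor Y' Y)
    (s t : indep g' f' f g) (a : biv B f) : pull s a = pull t a.
Proof.
pose st := indep_hcomp (indep_id_h f') s.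
(* The sides [k'] and [k] are kept general so that the identity laws can be eliminated; they become
   [g'] and [g] at the end. *)
have pullE (k' : mor X' X) (k : mor Y' Y) (r : indep k' f' f k) :
    g' \oc idm X' = k' -> g \oc idm Y' = k -> pull r a = pull st a.
  move=> e' e; case: k' / e' r; case: k / e => r.
  by rewrite (pull_comp (indep_id_h f') s r) (pull_comp (indep_id_h f') s st).
by rewrite (pullE _ _ s) ?(pullE _ _ t) // mcompm1.
Qed.

Lemma pullB (C : fmCategory) (B : bivTheory C) (X' X Y' Y : C)
    (g' : mor X' X) (f' : mor X' Y') (f : mor X Y) (g : mor Y' Y)
    (s : indep g' f' f g) :
  {morph (pull s : biv B f -> biv B f') : a b / a - b}.
Proof.
by move=> a b; apply: (addIr (pull s b)); rewrite -pullD !subrK.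
Qed.

Lemma pull0 (C : fmCategory) (B : bivTheory C) (X' X Y' Y : C)
    (g' : mor X' X) (f' : mor X' Y') (f : mor X Y) (g : mor Y' Y)
    (s : indep g' f' f g) : pull s (0 : biv B f) = 0.
Proof. by rewrite -[X in pull s X]subr0 pullB subrr. Qed.

Lemma prod_covB (C : fmCategory) (B : bivTheory C) (X Y : C)
    (f : mor X Y) (a a' : biv B f) (b : cov B Y) :
  prod_cov (a - a') b = prod_cov a b - prod_cov a' b.
Proof.
apply: (addIr (prod_cov a' b)).
by rewrite subrK /prod_cov -castD -bprodDl subrK.
Qed.

Lemma prod_cov0 (C : fmCategory) (B : bivTheory C) (X Y : C)
    (f : mor X Y) (b : cov B Y) : prod_cov (0 : biv B f) b = 0.
Proof. by rewrite -[X in prod_cov X]subr0 prod_covB subrr. Qed.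

Lemma prod_covA (C : fmCategory) (B : bivTheory C) (X Y Z : C)
    (f : mor X Y) (g : mor Y Z) (a : biv B f) (b : biv B g) (d : cov B Z) :
  prod_cov (bprod a b) d = prod_cov a (prod_cov b d).
Proof.
(* Transport of the right factor moves out of the product: eliminating [e] turns [e'] into a loop,
   which acts trivially. *)
have bprod_castr (k l : mor Y pt) (e : k = l)
    (e' : k \oc f = l \oc f) (x : biv B k) :
    bprod a (cast (B := @biv C B) e x) =
    cast (B := @biv C B) e' (bprod a x).
  by case: l / e e' => e'; rewrite !cast_loop.
rewrite /prod_cov (bprod_castr _ _ _ (congr1 (mcomp^~ f) (toPt_uniq _))).
rewrite -(prod_assoc (mcompA f g (toPt Z))) !cast_trans.
exact: cast_irrelevance.
Qed.

(** Compatibility of pushforward with products, in the form to which naturality of [c] applies. *)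
Lemma prod_cov_push (C : fmCategory) (B : bivTheory C) (X Y Z : C)
    (f : mor X Y) (g : mor Y Z) (cf : confined f) (a : biv B (g \oc f))
    (b : cov B Z) :
  prod_cov (push cf a) b = cov_push cf (prod_cov a b).
Proof.
have push_cast (k l : mor Y pt) (e : k = l)
    (e' : k \oc f = l \oc f) (x : biv B (k \oc f)) :
    push cf (cast (B := @biv C B) e' x) =
    cast (B := @biv C B) e (push cf x).
  by case: l / e e' => e'; rewrite !cast_loop.
rewrite /prod_cov /cov_push -(push_prod cf (mcompA f g (toPt Z))).
rewrite -(push_cast _ _ _ (congr1 (mcomp^~ f) (toPt_uniq _))) !cast_trans.
by congr push; exact: cast_irrelevance.
Qed.

Theorem mainTheorem6 (C : fmCategory)
  (Cfactor : indep_factor C) (Clift : indep_lift C)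
  (F H : bivTheory C)
  (c : forall X : C, {additive cov F X -> cov H X})
  (c_natural : forall (X Y : C) (f : mor X Y) (cf : confined f) (a : cov F X),
     c Y (cov_push cf a) = cov_push cf (c X a))
  (c_ext : forall (X Y P : C) (p : mor P X) (q : mor P Y)
     (s : cartesian p q (toPt X) (toPt Y)) (a : cov F X) (b : cov F Y),
     c P (ext_prod s a b) = ext_prod s (c X a) (c Y b))
  (oneF : cov F pt) (oneH : cov H pt)
  (oneF_unit : is_unit_pt oneF) (oneH_unit : is_unit_pt oneH)
  (c_one : c pt oneF = oneH) :
  is_bivariant_subtheory (Ftilde c) /\
  forall (X : C) (a : cov F X), Ftilde c a.
Proof.
split; last first.
  move=> X a; exists (c X a) => X' Y' g' f' g s b'.
  have eg := toPt_uniq g; subst g.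
  have := c_ext _ _ _ _ _ (indep_cartesian s) a b'.
  (* Exterior products use the independence proof given by [indep_product]; it is exchanged for
     [s]. *)
  by rewrite /ext_prod !(pull_irrelevance _ s).
have FtildeB X Y (f : mor X Y) (a b : biv F f) :
    Ftilde c a -> Ftilde c b -> Ftilde c (a - b).
  move=> [Ba Bac] [Bb Bbc]; exists (Ba - Bb) => X' Y' g' f' g s b'.
  by rewrite !pullB !prod_covB raddfB /= Bac Bbc.
apply: closed_bivariant_subtheory => //.
- move=> X Y f; exists 0 => X' Y' g' f' g s b'.
  by rewrite !pull0 !prod_cov0 raddf0.
- move=> X Y Z f g a b [Ba Bac] [Bb Bbc]; exists (bprod Ba Bb).
  move=> X' Z' h'' k h s d.
  have [Y' [h' [f' [g' [ek s1 s2]]]]] := Cfactor _ _ _ _ _ _ _ _ _ _ s.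
  subst k; rewrite !(pull_prod s1 s2) !prod_covA.
  (* The test for [a] is applied with [prod_cov (pull s2 b) d] as the class on [Y'], then the test
     for [b] with [d]. *)
  by rewrite Bac Bbc.
- move=> X Y Z f g cf a [Ba Bac]; exists (push cf Ba) => Y' Z' h' g' h t d.
  have [X' [h'' [f' s]]] := Clift _ _ _ _ _ _ _ _ _ _ cf t.
  have cf' := confined_left s cf.
  (* Naturality moves [c] inside the pushforward along [f'], leaving the test for [a] on the
     vertical composite of [s] and [t]. *)
  rewrite !(pull_push s t (indep_vcomp s t) cf cf') !prod_cov_push c_natural.
  by rewrite Bac.
- move=> X' X Y' Y g' f' f g s a [Ba Bac]; exists (pull s Ba).
  move=> X'' Y'' h' f'' h t d.
  (* The test square [t] pasted to [s] is a test square for [a]. *)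
  by rewrite -!(pull_comp t s (indep_hcomp t s)) Bac.
Qed.
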